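(* Assume that $\{\lambda_n\}_{n=1}^\infty\subset\mathbb{C}$ is an absolutely summable sequence (i.e. $\sum_{n=1}^\infty|\lambda_n|<\infty$) such that not all of its terms are zero. Let $$p_k=\sum_{n=1}^\infty \lambda_n^k,\qquad k\in\mathbb{N}.$$ Then $\{\lambda_n\}_{n=1}^\infty$ is a sequence of positive numbers if and only if for some $\lambda\ge\sup\{|\lambda_n| : n\in\mathbb{N}\}$, $$(-1)^j\Delta^j\left(\frac{p_{k+1}}{\lambda^{k+1}}\right)\ge 0,\qquad j,k\in\mathbb{N}_0 .$$
   Context: $\mathbb{N}=\{1,2,\dots\}$ and $\mathbb{N}_0=\mathbb{N}\cup\{0\}$. For a sequence $(m_n)_{n\ge0}$, $\Delta m_n=m_{n+1}-m_n$, and $\Delta^j$ is the $j$-th iterate of $\Delta$; in the claim $\Delta$ acts on the sequence indexed by $k$, i.e. on $m_k=p_{k+1}/\lambda^{k+1}$, $k\in\mathbb{N}_0$. For a complex number $c$, the assertion $c\ge0$ means that $c$ is real and nonnegative.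
   Formalization: ''Positive numbers'' is taken as nonnegative real numbers (zero terms allowed), since with strict positivity the ''if'' direction fails for the sequence (1,0,0,...) with λ=1. *)

(* Defs.v *)
From HB Require Import structures.
From mathcomp Require Import all_boot all_order all_algebra.
From mathcomp Require Import boolp classical_sets reals topology normedtype sequences.
From mathcomp Require Import complex.

Set Implicit Arguments.
Unset Strict Implicit.
Unset Printing Implicit Defensive.

Import Order.TTheory GRing.Theory Num.Theory.
Import numFieldNormedType.Exports.

Local Open Scope classical_set_scope.
Local Open Scope ring_scope.

(* Sequences (lambda_n), n >= 1, are encoded as l : nat -> R[i] with
   l n = lambda_(n+1).  The cast to numFieldType selects the topology that R[i]
   carries as a normed field, that is, the usual topology of the complex plane.
   The value is meaningful only when the series converges; for an absolutely
   summable l this is the case for all k >= 1. *)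
Definition power_sum (R : realType) (l : nat -> R[i]) (k : nat) : R[i] :=
  limn (series (fun n => l n ^+ k : (R[i] : numFieldType))).

(* The real sequence of moduli is used because the norm of R[i] has values in
   R[i] itself. *)
Definition absolutely_summable (R : realType) (l : nat -> R[i]) : Prop :=
  cvgn (series (fun n => Normc.normc (l n) : R)).

(* The forward difference (Delta m) n = m n.+1 - m n is telescope m. *)
Definition iter_diff (R : realType) (j : nat) (m : nat -> R[i]) : nat -> R[i] :=
  iter j telescope m.

(* Main.v *)
Require Import Defs.
From HB Require Import structures.
From mathcomp Require Import all_boot all_order all_algebra.
From mathcomp Require Import boolp classical_sets reals topology normedtype sequences.
From mathcomp Require Import complex ring lra.

Set Implicit Arguments.
Unset Strict Implicit.
Unset Printing Implicit Defensive.

Import Order.TTheory GRing.Theory Num.Theory.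
Import numFieldNormedType.Exports.

Local Open Scope classical_set_scope.
Local Open Scope ring_scope.
Local Open Scope complex_scope.

(** If all terms are nonnegative, take [lam] to be the supremum of the moduli and
put [x n := l n / lam], so that [0 <= x n <= 1].  The quantity
[(-1) ^+ j * iter_diff j _ k] is the sum over [n] of
[x n * (x n ^+ k * (1 - x n) ^+ j)], whose terms are nonnegative.

For the converse rescale in the same way, so that [`|x n| <= 1], and consider on
polynomials the functional [moment x p], the sum over [n] of [x n * p.[x n]].  The
hypothesis says that it is nonnegative on every [(1 - 'X) ^+ j * 'X^k]
([iter_diff_moment]), as in the Hausdorff moment problem.  The Bernstein partition of
unity then detects points off the interval [[0, 1]].  With [bern n k := (1 - 'X) ^+ (n - k) * 'X^k],
the sum over [k] of ['C(n, k) * bern n k] is [1], whereas the sum of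
['C(n, k) * `|(bern n k).[y]|] is [(`|1 - y| + `|y|) ^+ n], which grows
exponentially when [y] is not in [[0, 1]], because then [`|1 - y| + `|y| > 1]
([norm_split_gt1]).

Suppose some term [y = x m] is not a nonnegative real.  Since [x n] tends to [0], all
but finitely many terms satisfy [`|1 - x n| + `|x n| <= r] for a fixed [r] with
[1 < r < `|1 - y| + `|y|]; let [p] be a polynomial that vanishes at the exceptional
terms other than [y] and not at [y].  Estimate the sum over [k] of
['C(n, k) * `|moment x (bern n k * p)|] in two ways.  Positivity bounds it by a
constant independent of [n] ([moment_upper_bound]).  Evaluating the functional bounds
it from below by a positive multiple of [(`|1 - y| + `|y|) ^+ n] minus a multiple of
[r ^+ n] ([bernstein_lower_bound]).  These are incompatible for large [n]
([terms_ge0_of_moments]). *)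

(** * Limits in the complex plane *)

(* The cast selects the topology of [R[i]] as a normed field over itself. *)
Local Notation Creg R := ((R[i] : numFieldType)).
Local Notation normc := Normc.normc.

Lemma normr_normc (R : rcfType) (z : R[i]) : `|z| = (normc z)%:C.
Proof. by []. Qed.

Section ComplexLimits.
Variable R : realType.
Implicit Types u : nat -> Creg R.

Lemma cvg_Re u (a : Creg R) :
  u @ \oo --> a -> (fun n => complex.Re (u n) : R) @ \oo --> (complex.Re a : R).
Proof.
move=> ua; apply/cvgrPdist_lt => e e0.
have e0C : 0 < e%:C :> R[i] by rewrite ltcR.
move/cvgrPdist_lt : ua => /(_ _ e0C); apply: filterS => n un.
by rewrite -raddfB -ltcR; apply: le_lt_trans un; exact: normc_ge_Re.
Qed.

Lemma cvg_real_complex (v : nat -> R) (a : R) :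
  v @ \oo --> a -> (fun n => (v n)%:C : Creg R) @ \oo --> (a%:C : Creg R).
Proof.
move=> va; apply/cvgrPdist_lt => e e0.
have eE : (complex.Re e)%:C = e by apply: RRe_real; exact: gtr0_real.
have e0R : 0 < complex.Re e by rewrite -ltcR eE.
move/cvgrPdist_lt : va => /(_ _ e0R); apply: filterS => n vn.
rewrite -eE -raddfB normc_def /= expr0n addr0 sqrtr_sqr ltcR.
exact: vn.
Qed.

Lemma cvg_complex u (a b : R) :
  (fun n => complex.Re (u n) : R) @ \oo --> a ->
  (fun n => complex.Im (u n) : R) @ \oo --> b ->
  u @ \oo --> (a%:C + 'i%C * b%:C : Creg R).
Proof.
move=> ua ub.
have -> : u = fun n => ((complex.Re (u n))%:C + 'i%C * (complex.Im (u n))%:C : Creg R).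
  by apply/funext => n; rewrite -complexE.
apply: cvgD; first exact: cvg_real_complex.
by apply: cvgMl_tmp; exact: cvg_real_complex.
Qed.

(** The order of [R[i]] is partial: beside the inequality of real parts, the limit must
have the same imaginary part as the bound. *)
Lemma cvg_ge_complex u (a c : Creg R) :
  u @ \oo --> a -> (\forall n \near \oo, c <= u n) -> c <= a.
Proof.
move=> ua cu.
have iu : (fun n => u n * 'i%C) @ \oo --> (a * 'i%C : Creg R) by exact: cvgMr_tmp.
have ReMi (z : R[i]) : complex.Re (z * 'i%C) = - complex.Im z by rewrite ReiNIm.
have cst (r : R) : (fun=> r : R) @ \oo --> (r : R) by exact: cvg_cst.
rewrite lecE; apply/andP; split.
  apply/eqP/oppr_inj; rewrite -!ReMi; apply: le_anti; apply/andP; split.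
    apply: (ler_cvg_to (cvg_Re iu) (cst _)); apply: filterS cu => n.
    by rewrite !ReMi lecE => /andP[/eqP -> _].
  apply: (ler_cvg_to (cst _) (cvg_Re iu)); apply: filterS cu => n.
  by rewrite !ReMi lecE => /andP[/eqP -> _].
apply: (ler_cvg_to (cst _) (cvg_Re ua)); apply: filterS cu => n.
by rewrite lecE => /andP[_].
Qed.

Lemma normc_ge0 (z : R[i]) : 0 <= normc z.
Proof. by rewrite -lecR -normr_normc normr_ge0. Qed.

Lemma normc_ge_Im (z : R[i]) : `|complex.Im z| <= normc z.
Proof.
have := normc_ge_Re (z * 'i%C); rewrite ReiNIm normrN normr_normc Normc.normcM lecR.
by rewrite /Normc.normc expr0n expr1n add0r sqrtr1 mulr1.
Qed.

(** The real and the imaginary parts are dominated by the moduli, so that they converge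
by completeness of [R]. *)
Lemma abs_summable_cvg (f : nat -> Creg R) :
  cvgn (series (fun n => normc (f n) : R)) -> cvgn (series f).
Proof.
move=> fs.
have part (h : Creg R -> R) : (forall z, `|h z| <= normc z) ->
    cvgn (series (fun n => h (f n) : R)).
  move=> hle; apply: normed_cvg; apply: series_le_cvg fs => n.
  - exact: normr_ge0.
  - exact: normc_ge0.
  - exact: hle.
have seriesE (h : {additive Rcomplex R -> R}) :
    (fun n => h (series f n)) = series (fun n => h (f n) : R).
  by apply/funext => n; rewrite /series /= raddf_sum.
apply/cvg_ex; eexists; apply: cvg_complex.
  rewrite (seriesE (@complex.Re R)).
  by apply: part => z; rewrite -lecR; exact: normc_ge_Re.
by rewrite (seriesE (@complex.Im R)); apply: part => z; exact: normc_ge_Im.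
Qed.

Lemma sum_norm_le (x : nat -> R[i]) N : absolutely_summable x ->
  \sum_(i < N) `|x i| <= (limn (series (fun n => normc (x n) : R)))%:C.
Proof.
move=> x_summable.
under eq_bigr do rewrite normr_normc.
rewrite -(raddf_sum (real_complex R)) lecR.
have := @nondecreasing_cvgn_le R (series (fun n => normc (x n))) _ x_summable N.
rewrite /series /= big_mkord; apply.
by apply/nondecreasing_seqP => n; rewrite /= big_nat_recr//= lerDl normc_ge0.
Qed.

End ComplexLimits.

Lemma absolutely_summable_le_sup (R : realType) (l : nat -> R[i]) n :
  absolutely_summable l -> normc (l n) <= sup [set normc (l n) | n in [set: nat]].
Proof.
move=> ls; apply: sup_upper_bound; last by exists n.
split; first by exists (normc (l 0)), 0%N.
exists (limn (series (fun n => normc (l n) : R))) => _ [k _ <-].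
rewrite -lecR; apply: le_trans (sum_norm_le k.+1 ls).
by rewrite big_ord_recr /= -normr_normc lerDr; exact: sumr_ge0.
Qed.

(** * Bernstein polynomials off the unit interval *)

Section Bernstein.
Variable C : numClosedFieldType.
Implicit Types (x y : C) (p : {poly C}).

(** The two moduli dominate the real parts of [y] and [1 - y], which add up to [1];
equality for [y] forces [0 <= y]. *)
Lemma norm_split_gt1 y : ~~ (0 <= y) -> 1 < `|y| + `|1 - y|.
Proof.
move=> yN; have Re1 : 'Re y + 'Re (1 - y) = 1.
  by rewrite -raddfD addrC subrK; apply/Creal_ReP; exact: real1.
rewrite -[ltLHS]Re1; apply: ltr_leD; last exact: (leif_Re_Creal _).1.
by rewrite (lt_leif (leif_Re_Creal y)) yN.
Qed.

Definition coef_norm p : C := \sum_(i < size p) `|p`_i|.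

Lemma coef_norm_ge0 p : 0 <= coef_norm p.
Proof. by apply: sumr_ge0 => i _; exact: normr_ge0. Qed.

Lemma norm_horner_le p x : `|x| <= 1 -> `|p.[x]| <= coef_norm p.
Proof.
move=> x1; rewrite horner_coef; apply: le_trans (ler_norm_sum _ _ _) _.
apply: ler_sum => i _; rewrite normrM normrX ler_piMr ?normr_ge0//.
exact: exprn_ile1.
Qed.

Lemma horner_hausdorff j k x :
  ((1 - 'X) ^+ j * 'X^k).[x] = (1 - x) ^+ j * x ^+ k.
Proof. by rewrite !hornerE. Qed.

(** The binomial coefficient is left out, so that [bern n k] is literally one of the
polynomials on which the moments are assumed to be nonnegative. *)
Definition bern n k : {poly C} := (1 - 'X) ^+ (n - k) * 'X^k.

Lemma horner_bern n k x : (bern n k).[x] = (1 - x) ^+ (n - k) * x ^+ k.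
Proof. exact: horner_hausdorff. Qed.

Lemma sum_bern n : \sum_(k < n.+1) bern n k *+ 'C(n, k) = 1.
Proof. by rewrite -exprDn subrK expr1n. Qed.

Lemma sum_norm_bern n x :
  \sum_(k < n.+1) `|(bern n k).[x]| *+ 'C(n, k) = (`|1 - x| + `|x|) ^+ n.
Proof.
by rewrite exprDn; apply: eq_bigr => k _; rewrite horner_bern normrM !normrX.
Qed.

(** The indices with [x i = y] all contribute the same number to the inner sum, so they
cannot cancel.  At every other index either [p] vanishes or the Bernstein sum is at
most [r ^+ n]. *)
Lemma bernstein_lower_bound (x : nat -> C) y p N n (M r : C) :
  (exists2 i : nat, (i < N)%N & x i = y) -> 0 <= r ->
  (forall i, `|p.[x i]| <= M) ->
  (forall i, x i != y -> p.[x i] = 0 \/ `|1 - x i| + `|x i| <= r) ->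
  `|y * p.[y]| * (`|1 - y| + `|y|) ^+ n - M * (\sum_(i < N) `|x i|) * r ^+ n
  <= \sum_(k < n.+1) `|\sum_(i < N) x i * (bern n k * p).[x i]| *+ 'C(n, k).
Proof.
move=> [i0 i0N xi0] r0 pM pr.
have M0 : 0 <= M by apply: le_trans (pM 0%N).
pose head k := `|y * p.[y]| * `|(bern n k).[y]|.
pose tail k := \sum_(i < N | x i != y) `|x i * p.[x i]| * `|(bern n k).[x i]|.
have term k : head k - tail k <= `|\sum_(i < N) x i * (bern n k * p).[x i]|.
  rewrite (bigID (fun i : 'I_N => x i == y)) /=.
  apply: le_trans (lerB_normD _ _); apply: lerB.
    rewrite (eq_bigr (fun=> y * p.[y] * (bern n k).[y])); last first.
      by move=> i /eqP ->; rewrite hornerM; ring.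
    rewrite sumr_const /head -normrM normrMn -mulr_natr.
    rewrite ler_peMr ?normr_ge0// ler1n.
    by apply/card_gt0P; exists (Ordinal i0N); apply/eqP.
  apply: le_trans (ler_norm_sum _ _ _) _; apply: ler_sum => i _.
  by rewrite hornerM -normrM mulrA mulrAC.
apply: (@le_trans _ _ (\sum_(k < n.+1) (head k - tail k) *+ 'C(n, k))); last first.
  by apply: ler_sum => k _; rewrite lerMn2r term orbT.
under [leRHS]eq_bigr do rewrite mulrnBl.
rewrite sumrB; apply: lerB.
  by rewrite -sum_norm_bern mulr_sumr; apply: ler_sum => k _; rewrite mulrnAr.
under eq_bigr do rewrite -sumrMnl.
rewrite exchange_big /= big_mkcond /=.
rewrite mulr_sumr mulr_suml; apply: ler_sum => i _; case: ifPn => [xiy|_]; last first.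
  by rewrite !mulr_ge0 ?exprn_ge0.
under eq_bigr do rewrite -mulrnAr.
rewrite -mulr_sumr sum_norm_bern normrM; case: (pr _ xiy) => [->|ler].
  by rewrite normr0 mulr0 mul0r !mulr_ge0 ?exprn_ge0.
rewrite [M * _]mulrC; apply: ler_pM; rewrite ?exprn_ge0 ?addr_ge0 ?mulr_ge0//.
  by rewrite ler_wpM2l.
by rewrite lerXn2r ?nnegrE ?addr_ge0.
Qed.

End Bernstein.

(** * The moment functional *)

Section MomentFunctional.
Variables (R : realType) (x : nat -> R[i]).
Hypothesis x_summable : absolutely_summable x.
Hypothesis x_le1 : forall n, `|x n| <= 1.

Definition moment_series (p : {poly R[i]}) : nat -> Creg R :=
  series (fun n => x n * p.[x n] : Creg R).

Definition moment (p : {poly R[i]}) : R[i] := limn (moment_series p).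

Lemma moment_cvg p : moment_series p @ \oo --> (moment p : Creg R).
Proof.
suff : cvgn (moment_series p) by [].
apply: abs_summable_cvg.
apply: (@series_le_cvg _ _ (fun n => complex.Re (coef_norm p) * normc (x n))) => [n|n|n|].
- exact: normc_ge0.
- rewrite mulr_ge0 ?normc_ge0//.
  by have := coef_norm_ge0 p; rewrite lecE => /andP[].
- have cE : (complex.Re (coef_norm p))%:C = coef_norm p.
    by rewrite RRe_real ?ger0_real ?coef_norm_ge0.
  rewrite -lecR -normr_normc normrM mulrC rmorphM /= cE.
  by rewrite ler_wpM2r ?normr_ge0 ?norm_horner_le.
- exact: (@is_cvg_seriesZ _ (fun n => normc (x n))).
Qed.

Lemma momentP p (a : Creg R) : moment_series p @ \oo --> a -> moment p = a.
Proof. by move=> pa; apply: cvg_lim pa; exact: norm_hausdorff. Qed.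

Lemma momentD p q : moment (p + q) = moment p + moment q.
Proof.
apply: momentP.
have -> : moment_series (p + q) = moment_series p \+ moment_series q.
  apply/funext => n; rewrite /moment_series /series /= -big_split /=.
  by apply: eq_bigr => i _; rewrite hornerD mulrDr.
by apply: cvgD; exact: moment_cvg.
Qed.

Lemma momentZ c p : moment (c *: p) = c * moment p.
Proof.
apply: momentP.
have -> : moment_series (c *: p) = fun n => c * moment_series p n.
  apply/funext => n; rewrite /moment_series /series /= mulr_sumr.
  by apply: eq_bigr => i _; rewrite hornerZ mulrCA.
by apply: cvgMl_tmp; exact: moment_cvg.
Qed.

Lemma moment0 : moment 0 = 0.
Proof. by rewrite -[X in moment X](scale0r 0) momentZ mul0r. Qed.

Lemma momentB p q : moment (p - q) = moment p - moment q.
Proof. by rewrite -scaleN1r momentD momentZ mulN1r. Qed.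

Lemma moment_sum (I : finType) (F : I -> {poly R[i]}) :
  moment (\sum_i F i) = \sum_i moment (F i).
Proof. exact: (big_morph _ momentD moment0). Qed.

Lemma momentMn p n : moment (p *+ n) = moment p *+ n.
Proof. by rewrite -scaler_nat momentZ mulr_natl. Qed.

Lemma iter_diff_moment j k :
  (-1) ^+ j * iter_diff j (fun i => moment 'X^i) k = moment ((1 - 'X) ^+ j * 'X^k).
Proof.
elim: j k => [|j IHj] k; first by rewrite !expr0 !mul1r.
rewrite /iter_diff iterS /telescope -/(iter_diff j _).
rewrite exprS mulN1r mulNr mulrBr !IHj opprB -momentB; congr moment.
by rewrite (exprS (1 - 'X)) (exprS 'X); ring.
Qed.

Hypothesis moment_ge0 : forall j k, 0 <= moment ((1 - 'X) ^+ j * 'X^k).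

(** Each further factor ['X] lowers the moment, by the moment with a further factor
[1 - 'X] instead, which is nonnegative. *)
Lemma momentXM_le j k i :
  moment ((1 - 'X) ^+ j * 'X^k * 'X^i) <= moment ((1 - 'X) ^+ j * 'X^k).
Proof.
elim: i => [|i IHi]; first by rewrite expr0 mulr1.
apply: le_trans IHi; rewrite -subr_ge0 -momentB.
rewrite (_ : _ - _ = (1 - 'X) ^+ j.+1 * 'X^(k + i)).
  exact: moment_ge0.
by rewrite exprD (exprS (1 - 'X)) (exprS 'X); ring.
Qed.

Lemma moment_bern_le n k p :
  `|moment (bern _ n k * p)| <= coef_norm p * moment (bern _ n k).
Proof.
rewrite -[p in bern _ _ _ * p]coefK poly_def mulr_sumr moment_sum.
apply: le_trans (ler_norm_sum _ _ _) _; rewrite mulr_suml.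
apply: ler_sum => i _; rewrite -scalerAr momentZ normrM ler_wpM2l//.
by rewrite ger0_norm ?momentXM_le// -mulrA -exprD moment_ge0.
Qed.

(** The constant does not depend on [n] because the Bernstein polynomials sum to
[1]. *)
Lemma moment_upper_bound n p :
  \sum_(k < n.+1) `|moment (bern _ n k * p)| *+ 'C(n, k) <= coef_norm p * moment 1.
Proof.
rewrite -(sum_bern _ n) moment_sum mulr_sumr; apply: ler_sum => k _.
by rewrite momentMn mulrnAr lerMn2r moment_bern_le orbT.
Qed.

End MomentFunctional.

(** * Nonnegative moments force nonnegative terms *)

Lemma geometric_not_dominated (R : realType) (a k r s : R) :
  0 < a -> 0 < r -> r < s -> exists n, k * r ^+ n < a * s ^+ n.
Proof.
move=> a0 r0 rs; have s0 := lt_trans r0 rs.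
have z1 : `|r / s| < 1.
  by rewrite ger0_norm ?divr_ge0 ?ltW// ltr_pdivrMr// mul1r.
have /cvgrPdist_lt/(_ _ a0)[n _ /(_ n (leqnn n))] :=
  cvg_series_cvg_0 (@is_cvg_geometric_series _ k _ z1).
rewrite sub0r normrN /geometric /= => kn; exists n.
rewrite -ltr_pdivrMr ?exprn_gt0// -mulrA -expr_div_n.
exact: le_lt_trans (ler_norm _) kn.
Qed.

Section NonnegativeTerms.
Variables (R : realType) (x : nat -> R[i]).
Hypothesis x_summable : absolutely_summable x.
Hypothesis x_le1 : forall n, `|x n| <= 1.
Hypothesis moment_ge0 : forall j k, 0 <= moment x ((1 - 'X) ^+ j * 'X^k).

Lemma moment_sum_cvg p n :
  (fun N => \sum_(k < n.+1) `|moment_series x (bern _ n k * p) N| *+ 'C(n, k) : Creg R)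
    @ \oo --> (\sum_(k < n.+1) `|moment x (bern _ n k * p)| *+ 'C(n, k) : Creg R).
Proof.
apply: cvg_big => [|k _]; first exact: add_continuous.
rewrite -mulr_natr; under eq_fun do rewrite -mulr_natr.
by apply: cvgMr_tmp; apply: cvg_norm; exact: moment_cvg.
Qed.

Lemma terms_ge0_of_moments m : 0 <= x m.
Proof.
apply: contrapT => /negP yN; set y := x m in yN.
pose rho := normc (1 - y) + normc y.
have rho1 : 1 < rho.
  by have := norm_split_gt1 yN; rewrite addrC !normr_normc -rmorphD ltcR.
(* Terms with [`|x i| < d] satisfy [`|1 - x i| + `|x i| < 1 + 2 * d < rho]. *)
pose d := (rho - 1) / 3.
have [d0 drho] : 0 < d /\ 1 + 2 * d < rho by rewrite /d; split; lra.
have [N0 _ xsmall] : \forall i \near \oo, normc (x i) < d.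
  have /cvgrPdist_lt/(_ _ d0) := cvg_series_cvg_0 x_summable.
  by apply: filterS => i; rewrite sub0r normrN ger0_norm ?normc_ge0.
pose p := \prod_(i < N0 | x i != y) ('X - (x i)%:P).
have py0 : p.[y] != 0.
  rewrite horner_prod; apply/prodf_neq0 => i xiy.
  by rewrite hornerXsubC subr_eq0 eq_sym.
have y0 : y != 0 by apply: contra yN => /eqP ->.
pose S := limn (series (fun n => normc (x n) : R)).
pose r : R := 1 + 2 * d.
have pr i : x i != y -> p.[x i] = 0 \/ `|1 - x i| + `|x i| <= r%:C.
  move=> xiy; have [iN0|/xsmall xid] := ltnP i N0.
    left; rewrite horner_prod (bigD1 (Ordinal iN0))//=.
    by rewrite hornerXsubC subrr mul0r.
  right; apply: (@le_trans _ _ (1 + `|x i| + `|x i|)).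
    by rewrite lerD2r -[X in _ <= X + _]normr1 ler_normB.
  rewrite normr_normc -addrA -rmorphD -(rmorph1 (real_complex R)) -rmorphD lecR.
  by rewrite /r; lra.
pose A := normc (y * p.[y]).
have A0 : 0 < A by rewrite -ltcR -normr_normc normr_gt0 mulf_neq0.
pose c := coef_norm p.
have lower n : A%:C * rho%:C ^+ n - c * S%:C * r%:C ^+ n <= c * moment x 1.
  apply: le_trans (moment_upper_bound x_summable x_le1 moment_ge0 n p).
  (* The lower bound holds for all partial sums that contain the index [m], and passes
     to the limit. *)
  apply: (cvg_ge_complex (@moment_sum_cvg p n)).
  near=> N.
  have -> : \sum_(k < n.+1) `|moment_series x (bern _ n k * p) N| *+ 'C(n, k)
    = \sum_(k < n.+1) `|\sum_(i < N) x i * (bern _ n k * p).[x i]| *+ 'C(n, k).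
    by apply: eq_bigr => k _; rewrite /moment_series /series /= big_mkord.
  have r0 : 0 <= r%:C by rewrite ler0c /r; lra.
  apply: le_trans (bernstein_lower_bound (y := y) n _ r0 _ pr); last 2 first.
  - exists m => //; near: N; exact: nbhs_infty_gt.
  - by move=> i; exact: norm_horner_le.
  rewrite /rho rmorphD -!normr_normc; apply: lerB => //.
  by rewrite ler_wpM2r ?exprn_ge0// ler_wpM2l ?coef_norm_ge0 ?sum_norm_le.
have m1 : 0 <= moment x 1 by have := moment_ge0 0 0; rewrite !expr0 mulr1.
pose K := c * S%:C + c * moment x 1.
have S0 : 0 <= S%:C.
  by apply: le_trans (sum_norm_le 0 x_summable); rewrite big_ord0.
have KE : (complex.Re K)%:C = K.
  apply/RRe_real/ger0_real.
  by rewrite addr_ge0 ?mulr_ge0 ?coef_norm_ge0.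
have r0 : 0 < r by rewrite /r; lra.
have [n] := @geometric_not_dominated _ A (complex.Re K) r rho A0 r0 drho.
rewrite ltNge => /negP; apply.
rewrite -lecR !rmorphM !rmorphXn /= KE mulrDl -lerBlDl.
(* The constant term of the upper bound is absorbed, as [1 <= r ^+ n]. *)
apply: le_trans (lower n) _; rewrite ler_peMr ?mulr_ge0 ?coef_norm_ge0//.
by rewrite exprn_ege1// -(rmorph1 (real_complex R)) lecR /r; lra.
Unshelve. all: by end_near.
Qed.

End NonnegativeTerms.

(** * Power sums as moments of the rescaled sequence *)

Section Rescaling.
Variables (R : realType) (l : nat -> R[i]) (lam : R).
Hypothesis l_summable : absolutely_summable l.
Hypothesis lam_gt0 : 0 < lam.
Hypothesis l_le : forall n, normc (l n) <= lam.

Definition rescaled (n : nat) : R[i] := l n / lam%:C.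

Lemma norm_rescaled n : `|rescaled n| = (lam^-1 * normc (l n))%:C.
Proof.
rewrite normrM normfV (gtr0_norm (x := lam%:C)) ?ltcR//.
by rewrite rmorphM /= fmorphV mulrC.
Qed.

Lemma rescaled_le1 n : `|rescaled n| <= 1.
Proof.
by rewrite norm_rescaled -(rmorph1 (real_complex R)) lecR ler_pdivrMl// mulr1.
Qed.

Lemma rescaled_summable : absolutely_summable rescaled.
Proof.
rewrite /absolutely_summable.
have -> : (fun n => normc (rescaled n)) = fun n => lam^-1 * normc (l n).
  by apply/funext => n; apply: complexI; rewrite -norm_rescaled.
exact: (@is_cvg_seriesZ _ (fun n => normc (l n))).
Qed.

Lemma power_sum_moment k : power_sum l k.+1 / lam%:C ^+ k.+1 = moment rescaled 'X^k.
Proof.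
apply: canLR (mulfK _) _; first by rewrite expf_neq0// gt_eqF ?ltcR.
rewrite mulrC; set a := _ * moment _ _.
suff pa : series (fun n => l n ^+ k.+1 : Creg R) @ \oo --> (a : Creg R).
  by apply: cvg_lim pa; exact: norm_hausdorff.
have -> : series (fun n => l n ^+ k.+1 : Creg R)
    = fun N => lam%:C ^+ k.+1 * moment_series rescaled 'X^k N.
  apply/funext => N; rewrite /moment_series /series /= mulr_sumr.
  apply: eq_bigr => i _; rewrite hornerXn -exprS expr_div_n mulrC divfK//.
  by rewrite expf_neq0// gt_eqF ?ltcR.
apply: cvgMl_tmp; apply: moment_cvg; first exact: rescaled_summable.
exact: rescaled_le1.
Qed.

Lemma iter_diff_power_sum j k :
  (-1) ^+ j * iter_diff j (fun i => power_sum l i.+1 / lam%:C ^+ i.+1) k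
  = moment rescaled ((1 - 'X) ^+ j * 'X^k).
Proof.
rewrite -(iter_diff_moment rescaled_summable rescaled_le1).
by congr (_ * iter_diff _ _ _); apply/funext => i; exact: power_sum_moment.
Qed.

Lemma terms_ge0_iff_moments_ge0 :
  (forall n, 0 <= l n) <-> (forall j k, 0 <= moment rescaled ((1 - 'X) ^+ j * 'X^k)).
Proof.
have lE n : (0 <= l n) = (0 <= rescaled n).
  by rewrite /rescaled pmulr_lge0// invr_gt0 ltcR.
split=> [l0 j k|mom n]; last first.
  rewrite lE; exact: terms_ge0_of_moments rescaled_summable rescaled_le1 mom n.
apply: (cvg_ge_complex (@moment_cvg _ _ rescaled_summable rescaled_le1 _)).
apply: nearW => N; apply: sumr_ge0 => i _.
have xi0 : 0 <= rescaled i by rewrite -lE.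
have xi1 : 0 <= 1 - rescaled i.
  by rewrite subr_ge0 -[rescaled i]ger0_norm ?rescaled_le1.
rewrite horner_hausdorff; apply: mulr_ge0 => //.
by apply: mulr_ge0; exact: exprn_ge0.
Qed.

End Rescaling.

Theorem theorem2 (R : realType) (l : nat -> R[i])
    (l_summable : absolutely_summable l) (l_neq0 : exists n : nat, l n != 0) :
  (forall n : nat, 0 <= l n) <->
  (exists lam : R,
     sup [set Normc.normc (l n) | n in [set: nat]] <= lam /\
     (forall j k : nat,
        0 <= (-1) ^+ j *
             iter_diff j (fun i => power_sum l i.+1 / (lam%:C) ^+ i.+1) k)).
Proof.
set s := sup _.
have bounds lam : s <= lam -> 0 < lam /\ forall n, normc (l n) <= lam.
  move=> slam; have le n : normc (l n) <= lam.
    exact: le_trans (absolutely_summable_le_sup n l_summable) slam.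
  split=> //; have [n ln0] := l_neq0; apply: lt_le_trans (le n).
  by rewrite -ltcR -normr_normc normr_gt0.
split=> [l0|[lam [slam mom]]].
  have [s0 ls] := bounds s (lexx s).
  exists s; split=> // j k; rewrite iter_diff_power_sum//.
  by move: j k; apply/(terms_ge0_iff_moments_ge0 l_summable s0 ls).
have [lam0 ll] := bounds lam slam.
apply/(terms_ge0_iff_moments_ge0 l_summable lam0 ll) => j k.
by rewrite -iter_diff_power_sum.
Qed.
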